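(* Let $\psi:M^{2}\rightarrow \mathbb{L}^4$ be a spacelike surface which factors through the future lightcone $\Lambda^{+}$, i.e. $\psi(M^2)\subset\Lambda^+$, and let $\xi,\eta$ be the lightlike normal vector fields $$ \xi=\psi,\qquad \eta=\frac{1+\| \nabla\psi_{0}\|^2 }{2\,\psi_{0}^2}\, \xi -\frac{1}{\psi_{0}}\Big(\partial_{0}\circ \psi +\psi_{*}(\nabla \psi_{0})\Big). $$ Then the corresponding shape operators are $$A_{\xi}=-I \quad\text{and}\quad A_{\eta}= -\frac{1+\| \nabla \psi_{0}\|^2}{2\,\psi_{0}^{2}}\,I+\frac{1}{\psi_{0}}\,\nabla^{2}\psi_{0},$$ where $\nabla^{2} \psi_{0} (v)=\nabla_{v}(\nabla\psi_{0})$ for every $v\in T_{q}M^{2}$, $q\in M^2$, and $I$ is the identity transformation.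
   Context: $\mathbb{L}^4$ is Lorentz-Minkowski spacetime: $\mathbb{R}^4$ with the metric $\langle\,,\,\rangle=-(dx_0)^2+(dx_1)^2+(dx_2)^2+(dx_3)^2$. A spacelike surface is a smooth immersion $\psi:M^2\to\mathbb{L}^4$ of a connected $2$-dimensional smooth manifold such that the induced metric is Riemannian. $\Lambda^+=\{v\in\mathbb{L}^4:\langle v,v\rangle=0,\ v_0>0\}$. $\partial_0=\partial/\partial x_0$, $\partial_0\circ\psi$ is its restriction along $\psi$, $\psi_0$ is the $x_0$-component of $\psi$. $\nabla$ denotes both the Levi-Civita connection and the gradient of the induced metric. For a normal vector field $\zeta$, the shape operator $A_\zeta$ is defined by the Weingarten formula $\overline{\nabla}_X\zeta=-\psi_*(A_\zeta X)+\nabla^\perp_X\zeta$, where $\overline\nabla$ is the flat connection of $\mathbb{L}^4$ and $\nabla^\perp$ the normal connection. *)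

(* Defs.v *)
From HB Require Import structures.
From mathcomp Require Import all_boot all_order all_algebra.
From mathcomp Require Import all_classical all_reals all_analysis.
Set Implicit Arguments.
Unset Strict Implicit.
Unset Printing Implicit Defensive.
Import Order.TTheory GRing.Theory Num.Theory.
Import numFieldNormedType.Exports.
Local Open Scope classical_set_scope.
Local Open Scope ring_scope.

Section Smoothness.
Context {R : realType} {V W : normedModType R}.

Fixpoint Ck_on (k : nat) (U : set V) (f : V -> W) : Prop :=
  match k with
  | 0%N => forall x, U x -> {for x, continuous f}
  | k'.+1 => (forall x, U x -> differentiable f x) /\
             (forall v, Ck_on k' U (fun x => 'D_v f x))
  end.

(* Only meant for open U. *)
Definition smooth_on (U : set V) (f : V -> W) := forall k, Ck_on k U f.

End Smoothness.

Section Surfaces.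
Context {R : realType}.

Record chart (M : topologicalType) := Chart {
  source : set M;
  coord : M -> 'rV[R]_2;
  param : 'rV[R]_2 -> M;
  source_open : open source;
  target_open : open (coord @` source);
  coordK : forall p, source p -> param (coord p) = p;
  coord_continuous : forall p, source p -> {for p, continuous coord};
  param_continuous :
    forall x, (coord @` source) x -> {for x, continuous param} }.

(* The atlas is not required to be maximal: any smooth atlas determines the
   smooth structure. *)
Record surface := Surface {
  carrier :> topologicalType;
  atlas : set (chart carrier);
  surface_hausdorff : hausdorff_space carrier;
  surface_second_countable : @second_countable carrier;
  surface_connected : connected [set: carrier];
  atlas_cover : forall p : carrier, exists2 c, atlas c & source c p;
  atlas_smooth : forall c d, atlas c -> atlas d ->
    smooth_on (coord c @` (source c `&` source d)) (coord d \o param c) }.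

Definition smooth (M : surface) {W : normedModType R} (U : set M)
    (f : M -> W) : Prop :=
  forall c, atlas c -> smooth_on (coord c @` (source c `&` U)) (f \o param c).

Definition smooth_near (M : surface) {W : normedModType R} (q : M)
    (f : M -> W) : Prop :=
  exists U : set M, [/\ open U, U q & smooth U f].

(* A tangent vector at q is a directional derivative at q, acting on the
   functions that are smooth near q: in every chart around q it is the
   derivative along some vector a of R^2.  To have a functional on all of
   M -> R, and hence Leibniz equality of tangent vectors, its value is set to 0
   on the functions that are not smooth near q. *)
Definition is_tangent (M : surface) (q : M) (v : (M -> R) -> R) : Prop :=
  (forall f, ~ smooth_near q f -> v f = 0) /\
  (forall c, atlas c -> source c q -> exists a : 'rV[R]_2,
     forall f, smooth_near q f -> v f = 'D_a (f \o param c) (coord c q)).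

Definition tangent_pred (M : surface) (q : M) : {pred ((M -> R) -> R)} :=
  fun v => `[< is_tangent q v >].

Lemma smooth_near_differentiable (M : surface) (q : M) (f : M -> R) c :
  atlas c -> source c q -> smooth_near q f ->
  differentiable (f \o param c) (coord c q).
Proof.
move=> Ac cq [U [_ Uq fU]].
by have [+ _] := fU c Ac 1%N; apply; exists q.
Qed.

Lemma tangent_submod_closed (M : surface) (q : M) :
  submod_closed (tangent_pred q).
Proof.
split.
  apply/asboolP; split=> [//|c Ac cq]; exists 0 => f fq.
  by rewrite deriveE ?linear0//; exact: smooth_near_differentiable.
move=> k v w /asboolP[v0 vc] /asboolP[w0 wc]; apply/asboolP; split=> [f nf|].
  by rewrite !fctE v0// w0// scaler0 addr0.
move=> c Ac cq; have [a va] := vc c Ac cq; have [b wb] := wc c Ac cq.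
exists (k *: a + b) => f fq.
have df := smooth_near_differentiable Ac cq fq.
by rewrite !fctE va// wb// !deriveE// linearP.
Qed.

HB.instance Definition _ (M : surface) (q : M) :=
  GRing.isSubmodClosed.Build R ((M -> R) -> R) (tangent_pred q)
    (tangent_submod_closed q).

Record tangent (M : surface) (q : M) := Tangent {
  tangent_val :> (M -> R) -> R;
  _ : tangent_val \in tangent_pred q }.

HB.instance Definition _ (M : surface) (q : M) :=
  [isSub for @tangent_val M q].
HB.instance Definition _ (M : surface) (q : M) :=
  [Choice of tangent q by <:].
HB.instance Definition _ (M : surface) (q : M) :=
  [SubChoice_isSubLmodule of tangent q by <:].

Definition field (M : surface) := forall p : M, tangent p.

Definition smooth_field (M : surface) (U : set M) (X : field M) : Prop :=
  forall (U' : set M) (f : M -> R), open U' -> U' `<=` U ->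
    smooth U' f -> smooth U' (fun p => X p f).

Definition smooth_field_near (M : surface) (q : M) (X : field M) : Prop :=
  exists U : set M, [/\ open U, U q & smooth_field U X].

Definition metric (M : surface) := forall q : M, tangent q -> tangent q -> R.

(* nabla q v Y is the covariant derivative of Y along v at q.  As the covariant
   derivative is local, it is taken for every Y that is smooth on some
   neighbourhood of q; its value is irrelevant for the other Y. *)
Record affine_connection (M : surface)
    (nabla : forall q : M, tangent q -> field M -> tangent q) : Prop := {
  connection_linear : forall q (Y : field M), smooth_field_near q Y ->
    forall (k : R) (v w : tangent q),
      nabla q (k *: v + w) Y = k *: nabla q v Y + nabla q w Y;
  connection_additive : forall q (Y Z : field M),
    smooth_field_near q Y -> smooth_field_near q Z -> forall v : tangent q,
      nabla q v (fun p => Y p + Z p) = nabla q v Y + nabla q v Z;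
  connection_leibniz : forall q (f : M -> R) (Y : field M),
    smooth_near q f -> smooth_field_near q Y -> forall v : tangent q,
      nabla q v (fun p => f p *: Y p) = v f *: Y q + f q *: nabla q v Y;
  connection_smooth : forall (U : set M) (X Y : field M), open U ->
    smooth_field U X -> smooth_field U Y ->
    smooth_field U (fun p => nabla p (X p) Y) }.

Record levi_civita (M : surface) (g : metric M)
    (nabla : forall q : M, tangent q -> field M -> tangent q) : Prop := {
  levi_civita_connection : affine_connection nabla;
  levi_civita_torsion_free : forall q (X Y : field M),
    smooth_field_near q X -> smooth_field_near q Y ->
    forall f : M -> R, smooth_near q f ->
      (nabla q (X q) Y - nabla q (Y q) X) f =
      X q (fun p => Y p f) - Y q (fun p => X p f);
  levi_civita_metric : forall q (Y Z : field M),
    smooth_field_near q Y -> smooth_field_near q Z -> forall v : tangent q,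
      v (fun p => g p (Y p) (Z p)) =
      g q (nabla q v Y) (Z q) + g q (Y q) (nabla q v Z) }.

Definition is_gradient (M : surface) (g : metric M) (f : M -> R)
    (G : field M) : Prop :=
  smooth_field [set: M] G /\
  forall q (v : tangent q), g q (G q) v = v f.

Definition second_derivative (M : surface)
    (nabla : forall q : M, tangent q -> field M -> tangent q) (G : field M)
    (q : M) (v : tangent q) : tangent q := nabla q v G.

Definition lorentz (u v : 'rV[R]_4) : R :=
  - (u 0 0 * v 0 0) + \sum_(i < 3) u 0 (lift ord0 i) * v 0 (lift ord0 i).

Definition future_lightcone : set 'rV[R]_4 :=
  [set v | lorentz v v = 0 /\ 0 < v 0 0].

Definition partial0 : 'rV[R]_4 := delta_mx 0 0.

(* Componentwise derivative of an L^4-valued map along v.  For a vector field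
   along an immersion this is the flat connection of L^4, whose Christoffel
   symbols vanish in the standard coordinates. *)
Definition flat_connection (M : surface) (q : M) (v : tangent q)
    (Z : M -> 'rV[R]_4) : 'rV[R]_4 :=
  \row_i v (fun p => Z p 0 i).

Definition differential (M : surface) (psi : M -> 'rV[R]_4) (q : M)
    (v : tangent q) : 'rV[R]_4 :=
  \row_i v (fun p => psi p 0 i).

Definition induced_metric (M : surface) (psi : M -> 'rV[R]_4) : metric M :=
  fun q v w => lorentz (differential psi v) (differential psi w).

Record spacelike (M : surface) (psi : M -> 'rV[R]_4) : Prop := {
  spacelike_smooth : smooth [set: M] psi;
  spacelike_immersion : forall q : M,
    injective (fun v : tangent q => differential psi v);
  spacelike_riemannian : forall (q : M) (v : tangent q),
    v != 0 -> 0 < induced_metric psi v v }.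

Definition normal_at (M : surface) (psi : M -> 'rV[R]_4) (q : M)
    (n : 'rV[R]_4) : Prop :=
  forall w : tangent q, lorentz n (differential psi w) = 0.

Definition normal_field (M : surface) (psi Z : M -> 'rV[R]_4) : Prop :=
  smooth [set: M] Z /\ forall q, normal_at psi q (Z q).

Definition lightlike_field (M : surface) (Z : M -> 'rV[R]_4) : Prop :=
  forall q, Z q != 0 /\ lorentz (Z q) (Z q) = 0.

(* A_Z v is the tangent vector w given by the Weingarten decomposition of the
   derivative of Z along v into - psi_* w and a normal vector. *)
Definition shape_operator (M : surface) (psi Z : M -> 'rV[R]_4) (q : M)
    (v : tangent q) : tangent q :=
  xget 0 [set w : tangent q | exists2 n, normal_at psi q n &
    flat_connection v Z = - differential psi w + n].

End Surfaces.

Arguments surface R : clear implicits.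

(* Main.v *)
Require Import Defs.
From HB Require Import structures.
From mathcomp Require Import all_boot all_order all_algebra.
From mathcomp Require Import all_classical all_reals all_analysis.
From mathcomp Require Import ring lra.
Set Implicit Arguments.
Unset Strict Implicit.
Unset Printing Implicit Defensive.
Import Order.TTheory GRing.Theory Num.Theory.
Import numFieldNormedType.Exports.
Import Defs.
Local Open Scope classical_set_scope.
Local Open Scope ring_scope.

(** Differentiating <psi, psi> = 0 shows that psi is normal, and the gradient
    identity <psi_* grad psi_0, psi_* w> = w psi_0 = - <partial_0, psi_* w>
    shows that nu = partial_0 + psi_* grad psi_0 is normal.  Hence in
    eta = f psi - nu / psi_0 the derivatives of the coefficients f and
    1 / psi_0 contribute only normal vectors to D_v eta, the term f D_v psi
    contributes f psi_* v, and by the Gauss formula the tangential part of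
    D_v nu is psi_* (nabla_v grad psi_0).  The Gauss formula itself is the
    uniqueness of the Levi-Civita connection: D_X (psi_* Y) -
    psi_* (nabla_X Y) is symmetric in X and Y, and its product with psi_* Z is
    skew-symmetric in Y and Z, so this product vanishes. *)

(** * Calculus of C^k maps on open sets *)

(** The first-order expansion of [f] at [x] is also one for [g], since both remainders agree near 0.
    Uniqueness of the differential then identifies ['d g x] with ['d f x]. *)
Lemma near_eq_differentiable (R : realType) (V W : normedModType R)
    (f g : V -> W) (x : V) :
  (\forall y \near x, f y = g y) -> differentiable f x -> differentiable g x.
Proof.
move=> fg df.
have [cd fE] := (diff_locallyP _ _).1 df.
have gE : g \o shift x = cst (g x) + 'd f x +o_ 0 id.
  move/eqaddoP: fE => fE; apply/eqaddoP => e e0.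
  have := fE e e0; rewrite -(nbhs_singleton fg).
  move: fg; rewrite (near_shift 0) subr0 => fg0.
  by apply: filterS2 fg0 => h /= fgh; rewrite !fctE /= -fgh.
have dg := diff_unique cd gE.
by apply/diff_locallyP; rewrite dg.
Qed.

Section Ck_calculus.
Context {R : realType} {V : normedModType R}.
Implicit Types (W : normedModType R) (U : set V) (k : nat).

Lemma Ck_onS {W} k U (f : V -> W) : Ck_on k.+1 U f -> Ck_on k U f.
Proof.
elim: k f => [f [df _] x Ux|k IH f [df Df]].
  exact/differentiable_continuous/df.
by split=> // v; apply: IH.
Qed.

Lemma sub_Ck_on {W} k U U' (f : V -> W) :
  U' `<=` U -> Ck_on k U f -> Ck_on k U' f.
Proof.
move=> UU'; elim: k f => [f cf x /UU' Ux|k IH f [df Df]]; first exact: cf.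
by split=> [x /UU' Ux|v]; [exact: df|exact: IH (Df v)].
Qed.

Lemma open_near U x (P : V -> Prop) :
  open U -> U x -> (forall y, U y -> P y) -> \forall y \near x, P y.
Proof. by move=> oU Ux UP; apply: filterS UP _; exact: open_nbhs_nbhs. Qed.

(** On an open set, agreement on [U] is agreement near each point, so all directional derivatives
    agree too. This lets derivative formulas that hold only on [U] replace the actual
    derivatives. *)
Lemma eq_Ck_on {W} k U (f g : V -> W) : open U ->
  (forall x, U x -> f x = g x) -> Ck_on k U f -> Ck_on k U g.
Proof.
move=> oU; elim: k f g => [f g fg cf x Ux|k IH f g fg [df Df]].
  rewrite /= /prop_for /continuous_at -(fg _ Ux); apply: cvg_trans (cf _ Ux).
  by apply: near_eq_cvg; apply: open_near oU Ux _ => y Uy; exact: fg.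
split=> [x Ux|v].
  by apply: near_eq_differentiable (df x Ux); exact: open_near oU Ux fg.
apply: IH (Df v) => x Ux; apply: near_eq_derive; exact: open_near oU Ux fg.
Qed.

Lemma Ck_on_cst {W} k U (a : W) : Ck_on k U (fun=> a).
Proof.
elim: k a => [a x _|k IH a]; first exact: cvg_cst.
split=> [x _|v]; first exact: differentiable_cst.
rewrite [X in Ck_on _ _ X](_ : _ = fun=> 0); first exact: IH.
by apply/funext => x; exact: derive_cst.
Qed.

Lemma Ck_onD {W} k U (f g : V -> W) : open U ->
  Ck_on k U f -> Ck_on k U g -> Ck_on k U (fun x => f x + g x).
Proof.
move=> oU; elim: k f g => [f g cf cg x Ux|k IH f g [df Df] [dg Dg]].
  exact: continuousD (cf _ Ux) (cg _ Ux).
split=> [x Ux|v]; first exact: differentiableD (df _ Ux) (dg _ Ux).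
apply: eq_Ck_on (IH _ _ (Df v) (Dg v)) => // x Ux.
by rewrite deriveD//; apply: diff_derivable; first [exact: df|exact: dg].
Qed.

Lemma Ck_on_sum {W} k U (I : Type) (s : seq I) (F : I -> V -> W) : open U ->
  (forall i, Ck_on k U (F i)) -> Ck_on k U (fun x => \sum_(i <- s) F i x).
Proof.
move=> oU FC; elim: s => [|i s IH].
  rewrite (_ : (fun x => _) = fun=> 0); first exact: Ck_on_cst.
  by apply/funext => x; rewrite big_nil.
rewrite (_ : (fun x => _) = fun x => F i x + \sum_(j <- s) F j x).
  exact: Ck_onD.
by apply/funext => x; rewrite big_cons.
Qed.

Lemma derive_comp {W W' : normedModType R} (g : W -> W') (f : V -> W) x v :
  differentiable f x -> differentiable g (f x) ->
  'D_v (g \o f) x = 'D_('D_v f x) g (f x).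
Proof.
move=> df dg; rewrite (deriveE v (differentiable_comp df dg)).
by rewrite (deriveE _ dg) (deriveE v df) (diff_comp df dg).
Qed.

Lemma derive_linear_comp {W W' : normedModType R} (L : {linear W -> W'})
    (f : V -> W) x v : continuous L -> differentiable f x ->
  'D_v (L \o f) x = L ('D_v f x).
Proof.
move=> cL df; have dL y := linear_differentiable (f := L) y cL.
by rewrite derive_comp// deriveE// diff_lin.
Qed.

(** A continuous linear map commutes with directional derivatives, so the induction passes from [f]
    to ['D_v f] with the same [L]. *)
Lemma Ck_on_linear {W W' : normedModType R} k U (L : {linear W -> W'})
    (f : V -> W) : open U -> continuous L -> Ck_on k U f -> Ck_on k U (L \o f).
Proof.
move=> oU cL; elim: k f => [f cf x Ux|k IH f [df Df]].
  by apply: continuous_comp; [exact: cf|exact: cL].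
split=> [x Ux|v].
  by apply: differentiable_comp (df x Ux) _; exact: linear_differentiable.
apply: eq_Ck_on (IH _ (Df v)) => // x Ux.
by rewrite derive_linear_comp//; exact: df.
Qed.

Lemma Ck_onM k U (f g : V -> R) : open U ->
  Ck_on k U f -> Ck_on k U g -> Ck_on k U (fun x => f x * g x).
Proof.
move=> oU; elim: k f g => [f g cf cg x Ux|k IH f g Cf Cg].
  exact: continuousM (cf _ Ux) (cg _ Ux).
have [[df Df] [dg Dg]] := (Cf, Cg).
split=> [x Ux|v]; first exact: differentiableM (df _ Ux) (dg _ Ux).
have C := Ck_onD oU (IH _ _ (Ck_onS Cf) (Dg v)) (IH _ _ (Ck_onS Cg) (Df v)).
apply: eq_Ck_on C => // x Ux.
by rewrite deriveM//; apply: diff_derivable; first [exact: df|exact: dg].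
Qed.

(** The derivative of 1/f is -(1/f)^2 times that of f; by induction it is a product of functions of
    class C^k. *)
Lemma Ck_onV k U (f : V -> R) : open U -> (forall x, U x -> f x != 0) ->
  Ck_on k U f -> Ck_on k U (fun x => (f x)^-1).
Proof.
move=> oU f0; elim: k => [cf x Ux|k IH Cf].
  exact: continuousV (f0 _ Ux) (cf _ Ux).
have [df Df] := Cf.
split=> [x Ux|v]; first exact: differentiableV (df _ Ux) (f0 _ Ux).
have Ci := IH (Ck_onS Cf).
have Ci2 := Ck_onM oU (Ck_on_cst k U (-1 : R)) (Ck_onM oU Ci Ci).
have C := Ck_onM oU Ci2 (Df v).
apply: eq_Ck_on C => // x Ux.
rewrite deriveV ?f0//; last exact/diff_derivable/df.
by rewrite mulN1r expr2 invfM.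
Qed.

End Ck_calculus.

Definition mx_coord {R : realType} {m n} (i : 'I_m) (j : 'I_n)
  (A : 'M[R]_(m, n)) : R := A i j.

Lemma mx_coord_is_linear {R : realType} {m n} (i : 'I_m) (j : 'I_n) :
  linear (@mx_coord R m n i j).
Proof. by move=> k A B; rewrite /mx_coord !mxE. Qed.

HB.instance Definition _ {R : realType} {m n} (i : 'I_m) (j : 'I_n) :=
  GRing.isLinear.Build R 'M[R]_(m, n) R _ (@mx_coord R m n i j)
    (mx_coord_is_linear i j).

Section Ck_coordinates.
Context {R : realType} {V : normedModType R}.

Lemma Ck_on_coord n k (U : set V) (f : V -> 'rV[R]_n.+1) i : open U ->
  Ck_on k U f -> Ck_on k U (fun x => f x 0 i).
Proof.
move=> oU; apply: (Ck_on_linear (L := mx_coord 0 i)) => //.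
exact: matrix_normedtype.coord_continuous.
Qed.

(** The map is the sum of its coordinates times basis vectors, and [r |-> r *: delta_mx 0 i] is
    continuous and linear. *)
Lemma Ck_on_row n k (U : set V) (f : V -> 'rV[R]_n.+1) : open U ->
  (forall i, Ck_on k U (fun x => f x 0 i)) -> Ck_on k U f.
Proof.
move=> oU Cf.
rewrite (_ : f = fun x => \sum_i f x 0 i *: delta_mx 0 i); last first.
  by apply/funext => x; rewrite -row_sum_delta.
apply: Ck_on_sum => // i.
have lin : linear (fun r : R => r *: delta_mx 0 i : 'rV[R]_n.+1).
  by move=> k' a b; rewrite scalerDl scalerA.
pose L := GRing.isLinear.Build R R 'rV[R]_n.+1 _ _ lin.
pose L' : {linear _ -> _} :=
  HB.pack (fun r : R => r *: delta_mx 0 i : 'rV[R]_n.+1) L.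
by apply: (Ck_on_linear (L := L')) => //; exact: scalel_continuous.
Qed.

(** The chain rule differentiates [f] along ['D_v g x], which varies with [x], whereas [Ck_on]
    speaks of constant directions. Expanding it in the standard basis leaves partial derivatives of
    [f], to which the induction hypothesis applies. *)
Lemma Ck_on_comp m k (U : set V) (U' : set 'rV[R]_m.+1) (f : 'rV[R]_m.+1 -> R)
    (g : V -> 'rV[R]_m.+1) : open U -> open U' ->
  (forall x, U x -> U' (g x)) ->
  Ck_on k U g -> Ck_on k U' f -> Ck_on k U (f \o g).
Proof.
move=> oU oU' gU; elim: k f => [f cg cf x Ux|k IH f Cg [df Df]].
  by apply: continuous_comp; [exact: cg|exact/cf/gU].
have [dg Dg] := Cg.
split=> [x Ux|v]; first by apply: differentiable_comp; [exact: dg|exact/df/gU].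
apply: (@eq_Ck_on _ _ _ _ _ (fun x => \sum_i
    'D_v g x 0 i * ('D_(delta_mx 0 i) f \o g) x)) => // [x Ux|].
  have dgx := dg _ Ux; have dfx := df _ (gU _ Ux).
  rewrite [RHS]derive_comp// [RHS](deriveE _ dfx).
  rewrite [in RHS](row_sum_delta ('D_v g x)) linear_sum.
  by apply: eq_bigr => i _; rewrite linearZ -[in RHS]deriveE.
apply: Ck_on_sum => // i; apply: Ck_onM => //.
  by apply: Ck_on_coord => //; exact: Dg.
by apply: IH; [exact: Ck_onS|exact: Df].
Qed.

End Ck_coordinates.

(** * Smooth functions, tangent vectors and local vector fields *)

Section SmoothFunctions.
Context {R : realType} {M : surface R}.
Implicit Types (U : set M) (q : M).

(** Near [coord c p] the image consists of the points of the open target that [param c] sends into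
    [U], and [param c] is continuous there. *)
Lemma open_chart_image (c : @chart R M) U :
  open U -> open (coord c @` (source c `&` U)).
Proof.
move=> oU; rewrite openE => _ [p [cp Up] <-]; rewrite /interior.
have tp : (coord c @` source c) (coord c p) by exists p.
have : nbhs (coord c p) (coord c @` source c `&` param c @^-1` U).
  apply: filterI.
    by apply: open_nbhs_nbhs; split=> //; exact: target_open.
  apply: (param_continuous tp); rewrite coordK//.
  exact: open_nbhs_nbhs.
apply: filterS => _ [[p' cp' <-]]; rewrite /preimage/= coordK// => Up'.
by exists p'.
Qed.

Lemma sub_smooth {W : normedModType R} U U' (f : M -> W) :
  U' `<=` U -> smooth U f -> smooth U' f.
Proof.
move=> UU' fU c Ac k; apply: sub_Ck_on (fU c Ac k).
by apply: image_subset => p [cp /UU'].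
Qed.

Lemma smooth_cst {W : normedModType R} U (a : W) : smooth U (fun=> a).
Proof. by move=> c Ac k; exact: Ck_on_cst. Qed.

Lemma smoothD {W : normedModType R} U (f g : M -> W) : open U ->
  smooth U f -> smooth U g -> smooth U (fun p => f p + g p).
Proof.
move=> oU fU gU c Ac k.
exact: Ck_onD (open_chart_image oU) (fU c Ac k) (gU c Ac k).
Qed.

Lemma smoothM U (f g : M -> R) : open U ->
  smooth U f -> smooth U g -> smooth U (fun p => f p * g p).
Proof.
move=> oU fU gU c Ac k.
exact: Ck_onM (open_chart_image oU) (fU c Ac k) (gU c Ac k).
Qed.

Lemma smoothV U (f : M -> R) : open U -> (forall p, U p -> f p != 0) ->
  smooth U f -> smooth U (fun p => (f p)^-1).
Proof.
move=> oU f0 fU c Ac k.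
apply: Ck_onV (open_chart_image oU) _ (fU c Ac k) => _ [p [cp Up] <-] /=.
by rewrite coordK//; exact: f0.
Qed.

Lemma smooth_sum {W : normedModType R} U (I : Type) (s : seq I)
    (F : I -> M -> W) : open U ->
  (forall i, smooth U (F i)) -> smooth U (fun p => \sum_(i <- s) F i p).
Proof.
move=> oU FU c Ac k.
exact: Ck_on_sum (open_chart_image oU) (fun i => FU i c Ac k).
Qed.

Lemma smooth_coord n U (f : M -> 'rV[R]_n.+1) i : open U ->
  smooth U f -> smooth U (fun p => f p 0 i).
Proof.
move=> oU fU c Ac k.
exact: Ck_on_coord (open_chart_image oU) (fU c Ac k).
Qed.

Lemma smooth_row n U (f : M -> 'rV[R]_n.+1) : open U ->
  (forall i, smooth U (fun p => f p 0 i)) -> smooth U f.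
Proof.
move=> oU fU c Ac k.
exact: Ck_on_row (open_chart_image oU) (fun i => fU i c Ac k).
Qed.

Lemma smooth_nearT {W : normedModType R} q (f : M -> W) :
  smooth [set: M] f -> smooth_near q f.
Proof. by move=> fT; exists setT; split=> //; exact: openT. Qed.

Lemma smooth_near_cst {W : normedModType R} q (a : W) :
  smooth_near q (fun=> a).
Proof. exact/smooth_nearT/smooth_cst. Qed.

Lemma smooth_near2 {W1 W2 W3 : normedModType R} q (f : M -> W1) (g : M -> W2)
    (h : M -> W3) :
  (forall U, open U -> smooth U f -> smooth U g -> smooth U h) ->
  smooth_near q f -> smooth_near q g -> smooth_near q h.
Proof.
move=> fgh [U [oU Uq fU]] [V [oV Vq gV]]; exists (U `&` V).
have oUV := openI oU oV; split=> //; apply: fgh => //.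
  by apply: sub_smooth fU; exact: subIsetl.
by apply: sub_smooth gV; exact: subIsetr.
Qed.

Lemma smooth_nearD {W : normedModType R} q (f g : M -> W) :
  smooth_near q f -> smooth_near q g -> smooth_near q (fun p => f p + g p).
Proof. by apply: smooth_near2 => U; exact: smoothD. Qed.

Lemma smooth_nearM q (f g : M -> R) :
  smooth_near q f -> smooth_near q g -> smooth_near q (fun p => f p * g p).
Proof. by apply: smooth_near2 => U; exact: smoothM. Qed.

Lemma smooth_near_sum {W : normedModType R} q (I : Type) (s : seq I)
    (F : I -> M -> W) : (forall i, smooth_near q (F i)) ->
  smooth_near q (fun p => \sum_(i <- s) F i p).
Proof.
move=> Fq; elim: s => [|i s IH].
  rewrite (_ : (fun p => _) = fun=> 0); first exact: smooth_near_cst.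
  by apply/funext => p; rewrite big_nil.
rewrite (_ : (fun p => _) = fun p => F i p + \sum_(j <- s) F j p).
  exact: smooth_nearD.
by apply/funext => p; rewrite big_cons.
Qed.

End SmoothFunctions.

(** * Tangent vectors as derivations *)

Section TangentVectors.
Context {R : realType} {M : surface R} {q : M}.
Implicit Types (v : tangent q) (f g : M -> R).

(** A single chart and direction serve all functions smooth near [q], so the rules for ['D_a] carry
    over to [v]. *)
Lemma tangent_derive v : exists c : @chart R M, exists2 a : 'rV[R]_2,
  atlas c /\ source c q & forall f, smooth_near q f ->
  derivable (f \o param c) (coord c q) a /\
  v f = 'D_a (f \o param c) (coord c q).
Proof.
have [c Ac cq] := atlas_cover q; exists c.
case: v => v /= /asboolP [_ /(_ c Ac cq)[a va]]; exists a => // f fq.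
split; last exact: va.
exact/diff_derivable/smooth_near_differentiable.
Qed.

Lemma tangent_cst v (k : R) : v (fun=> k) = 0.
Proof.
have [c [a [Ac cq] va]] := tangent_derive v.
have [_ ->] := va _ (smooth_near_cst q k); exact: derive_cst.
Qed.

Lemma tangentfD v f g : smooth_near q f -> smooth_near q g ->
  v (fun p => f p + g p) = v f + v g.
Proof.
move=> fq gq; have [c [a [Ac cq] va]] := tangent_derive v.
have [_ ->] := va _ (smooth_nearD fq gq).
by have [[df ->] [dg ->]] := (va _ fq, va _ gq); exact: deriveD.
Qed.

Lemma tangentfM v f g : smooth_near q f -> smooth_near q g ->
  v (fun p => f p * g p) = f q * v g + g q * v f.
Proof.
move=> fq gq; have [c [a [Ac cq] va]] := tangent_derive v.
have [_ ->] := va _ (smooth_nearM fq gq).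
have [[df ->] [dg ->]] := (va _ fq, va _ gq).
by rewrite [LHS](deriveM df dg) /= coordK.
Qed.

Lemma tangentf_sum v (I : Type) (s : seq I) (F : I -> M -> R) :
  (forall i, smooth_near q (F i)) ->
  v (fun p => \sum_(i <- s) F i p) = \sum_(i <- s) v (F i).
Proof.
move=> Fq; elim: s => [|i s IH].
  rewrite big_nil -[RHS](tangent_cst v 0); congr (tangent_val v _).
  by apply/funext => p; rewrite big_nil.
rewrite big_cons -IH -tangentfD//; last exact: smooth_near_sum.
by congr (tangent_val v _); apply/funext => p; rewrite big_cons.
Qed.

Lemma tangent_addE v (w : tangent q) f : (v + w) f = v f + w f.
Proof. by []. Qed.

Lemma tangent_oppE v f : (- v) f = - v f.
Proof. by []. Qed.

End TangentVectors.

(** * Extending tangent vectors to local coordinate fields *)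

Section Extension.
Context {R : realType} {M : surface R}.

(** The conditional enforces the default value 0 that [is_tangent] prescribes. *)
Definition coord_derivation (c : @chart R M) (a : 'rV[R]_2) (p : M) :
    (M -> R) -> R := fun f =>
  if `[< smooth_near p f >] then 'D_a (f \o param c) (coord c p) else 0.

(** In another chart the direction becomes the image of [a] under the derivative of the transition
    map [t], by the chain rule. *)
Lemma coord_derivation_tangent (c : @chart R M) a p : atlas c -> source c p ->
  coord_derivation c a p \in tangent_pred p.
Proof.
move=> Ac cp; apply/asboolP; split=> [f nf|d Ad dp].
  by rewrite /coord_derivation asboolF.
pose t := coord d \o param c.
have cdp : (coord c @` (source c `&` source d)) (coord c p) by exists p.
have dt : differentiable t (coord c p).
  by have [+ _] := atlas_smooth Ac Ad 1%N; apply.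
exists ('D_a t (coord c p)) => f fp; rewrite /coord_derivation asboolT//.
have df := smooth_near_differentiable Ad dp fp.
have tp : t (coord c p) = coord d p by rewrite /t /= coordK.
have df' : differentiable (f \o param d) (t (coord c p)) by rewrite tp.
have ocd : open (coord c @` (source c `&` source d)).
  exact/open_chart_image/source_open.
have -> : 'D_a (f \o param c) (coord c p) =
    'D_a ((f \o param d) \o t) (coord c p); last first.
  by rewrite derive_comp// tp.
(* The two expressions of [f] agree on the image of the chart overlap, an open set around
   [coord c p]. *)
apply: near_eq_derive.
apply: open_near ocd cdp _ => _ [p' [cp' dp'] <-].
by rewrite /t /= coordK// coordK.
Qed.

(** A field needs a value at every point; [insubd] supplies 0 wherever the derivation fails to be
    tangent. The field is of interest on [source c]. *)
Definition coord_field (c : @chart R M) (a : 'rV[R]_2) : field M :=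
  fun p => insubd (0 : tangent p) (coord_derivation c a p).

Lemma coord_fieldE (c : @chart R M) a p f : atlas c -> source c p ->
  smooth_near p f -> coord_field c a p f = 'D_a (f \o param c) (coord c p).
Proof.
move=> Ac cp fp.
have cE : coord_field c a p = coord_derivation c a p :> (_ -> _).
  exact: insubdK (coord_derivation_tangent _ Ac cp).
by rewrite cE /coord_derivation asboolT.
Qed.

(** Read in a chart [d], the function [X f] is ['D_a (f \o param c)] composed with the transition
    map from [d] to [c]. *)
Lemma coord_field_smooth (c : @chart R M) a : atlas c ->
  smooth_field (source c) (coord_field c a).
Proof.
move=> Ac U f oU Uc fU d Ad k.
have oUd := open_chart_image (c := d) oU.
apply: (@eq_Ck_on _ _ _ _ _
    ('D_a (f \o param c) \o (coord c \o param d))) => //.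
  move=> _ [p [dp Up] <-] /=; rewrite coordK// coord_fieldE//; first exact: Uc.
  by exists U.
apply: (Ck_on_comp (U' := coord c @` (source c `&` U))) => //.
- exact: open_chart_image.
- move=> _ [p [dp Up] <-] /=; rewrite coordK//; exists p => //.
  by split=> //; exact: Uc.
- apply: sub_Ck_on (atlas_smooth Ad Ac k).
  by apply: image_subset => p [dp /Uc].
(* Taking ['D_a] costs one order of differentiability, hence [k.+1]. *)
- by have [_] := fU c Ac k.+1; apply.
Qed.

(** The field with constant coefficients in a chart does it. Extensions are needed because the
    axioms of the Levi-Civita connection concern fields. *)
Lemma tangent_extension (q : M) (v : tangent q) :
  exists2 X : field M, smooth_field_near q X & X q = v.
Proof.
have [c Ac cq] := atlas_cover q.
have /asboolP[v0 /(_ c Ac cq)[a va]] := valP v.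
exists (coord_field c a).
  exists (source c); split=> //; first exact: source_open.
  exact: coord_field_smooth.
have E : coord_field c a q = v :> ((M -> R) -> R); last exact: val_inj.
apply/funext => f.
have [fq|nfq] := pselect (smooth_near q f).
  by rewrite coord_fieldE// va.
(* On functions not smooth near [q] both functionals take the default value 0. *)
rewrite v0//.
have /asboolP[-> //] := valP (coord_field c a q).
Qed.

End Extension.

(** * Surfaces in Lorentz-Minkowski space *)

Section Lorentz.
Context {R : realType}.
Implicit Types (u v w : 'rV[R]_4) (k : R).

(** The diagonal of the Gram matrix; it merges the time and space parts into one sum, so that
    bilinearity is checked term by term. *)
Definition lorentz_sign (i : 'I_4) : R := if i == 0 then -1 else 1.

Lemma lorentzE u v :
  lorentz u v = \sum_i lorentz_sign i * (u 0 i * v 0 i).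
Proof.
rewrite big_ord_recl /lorentz_sign eqxx mulN1r; congr (_ + _).
by apply: eq_bigr => i _; rewrite mul1r.
Qed.

Lemma lorentzC u v : lorentz u v = lorentz v u.
Proof.
by rewrite !lorentzE; apply: eq_bigr => i _; rewrite (mulrC (u 0 i)).
Qed.

Lemma lorentzDl u v w : lorentz (u + v) w = lorentz u w + lorentz v w.
Proof.
rewrite !lorentzE -big_split; apply: eq_bigr => i _.
by rewrite mxE mulrDl mulrDr.
Qed.

Lemma lorentzZl k u w : lorentz (k *: u) w = k * lorentz u w.
Proof.
rewrite !lorentzE mulr_sumr; apply: eq_bigr => i _.
by rewrite mxE -mulrA mulrCA.
Qed.

Lemma lorentzNl u w : lorentz (- u) w = - lorentz u w.
Proof. by rewrite -scaleN1r lorentzZl mulN1r. Qed.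

Lemma lorentzDr u v w : lorentz w (u + v) = lorentz w u + lorentz w v.
Proof. by rewrite lorentzC lorentzDl !(lorentzC w). Qed.

Lemma lorentzZr k u w : lorentz w (k *: u) = k * lorentz w u.
Proof. by rewrite lorentzC lorentzZl lorentzC. Qed.

Lemma lorentzNr u w : lorentz w (- u) = - lorentz w u.
Proof. by rewrite lorentzC lorentzNl lorentzC. Qed.

Lemma lorentz_partial0 u : lorentz partial0 u = - u 0 0.
Proof.
rewrite /lorentz /partial0 mxE !eqxx mul1r big1 ?addr0// => i _.
by rewrite mxE mul0r.
Qed.

End Lorentz.

Definition lorentz_bilinear {R : realType} := (@lorentzDl R, @lorentzZl R,
  @lorentzNl R, @lorentzDr R, @lorentzZr R, @lorentzNr R).

(** * Differentiating maps into Lorentz-Minkowski space *)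

Section FlatConnection.
Context {R : realType} {M : surface R} {q : M}.
Implicit Types (v w : tangent q) (Y Z : M -> 'rV[R]_4) (psi : M -> 'rV[R]_4).

Definition coords_smooth_near (p : M) Z :=
  forall i, smooth_near p (fun p' => Z p' 0 i).

(** The signs of the metric are constant, so the product rule in each coordinate shows that the flat
    connection is metric. *)
Lemma tangent_lorentz v Y Z :
  coords_smooth_near q Y -> coords_smooth_near q Z ->
  v (fun p => lorentz (Y p) (Z p)) =
  lorentz (flat_connection v Y) (Z q) + lorentz (Y q) (flat_connection v Z).
Proof.
move=> Yq Zq.
rewrite (_ : (fun p => _) =
    fun p => \sum_i lorentz_sign i * (Y p 0 i * Z p 0 i)); last first.
  by apply/funext => p; rewrite lorentzE.
have YZq i := smooth_nearM (Yq i) (Zq i).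
rewrite tangentf_sum => [|i]; last first.
  by apply: smooth_nearM; [exact: smooth_near_cst|exact: YZq].
rewrite !lorentzE -big_split; apply: eq_bigr => i _.
rewrite tangentfM//; last exact: smooth_near_cst.
by rewrite tangent_cst mulr0 addr0 tangentfM//= !mxE; ring.
Qed.

Lemma flat_connectionD v Y Z :
  coords_smooth_near q Y -> coords_smooth_near q Z ->
  flat_connection v (fun p => Y p + Z p) =
  flat_connection v Y + flat_connection v Z.
Proof.
move=> Yq Zq; apply/rowP => i; rewrite !mxE -tangentfD//.
by congr (tangent_val v _); apply/funext => p; rewrite mxE.
Qed.

Lemma flat_connectionZ v (f : M -> R) Z :
  smooth_near q f -> coords_smooth_near q Z ->
  flat_connection v (fun p => f p *: Z p) =
  v f *: Z q + f q *: flat_connection v Z.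
Proof.
move=> fq Zq; apply/rowP => i; rewrite !mxE addrC (mulrC (v f)) -tangentfM//.
by congr (tangent_val v _); apply/funext => p; rewrite mxE.
Qed.

Lemma flat_connection_cst v (a : 'rV[R]_4) :
  flat_connection v (fun=> a) = 0.
Proof. by apply/rowP => i; rewrite !mxE tangent_cst. Qed.

Lemma coords_smooth_nearZ (f : M -> R) Z :
  smooth_near q f -> coords_smooth_near q Z ->
  coords_smooth_near q (fun p => f p *: Z p).
Proof.
move=> fq Zq i; rewrite (_ : (fun p => _) = fun p => f p * Z p 0 i).
  exact: smooth_nearM.
by apply/funext => p; rewrite mxE.
Qed.

Lemma coords_smooth_near_cst (a : 'rV[R]_4) : coords_smooth_near q (fun=> a).
Proof. by move=> i; exact: smooth_near_cst. Qed.

Lemma differentialD psi v w :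
  differential psi (v + w) = differential psi v + differential psi w.
Proof. by apply/rowP => i; rewrite !mxE. Qed.

Lemma differentialZ psi k v :
  differential psi (k *: v) = k *: differential psi v.
Proof. by apply/rowP => i; rewrite !mxE. Qed.

Lemma differentialN psi v : differential psi (- v) = - differential psi v.
Proof. by apply/rowP => i; rewrite !mxE. Qed.

End FlatConnection.

Section SmoothRows.
Context {R : realType} {M : surface R}.
Implicit Types (U : set M) (Y Z : M -> 'rV[R]_4).

Lemma smooth_rowZ n U (f : M -> R) (Z : M -> 'rV[R]_n.+1) : open U ->
  smooth U f -> smooth U Z -> smooth U (fun p => f p *: Z p).
Proof.
move=> oU fU ZU; apply: smooth_row => // i.
rewrite (_ : (fun p => _) = fun p => f p * Z p 0 i).
  by apply: smoothM => //; exact: smooth_coord.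
by apply/funext => p; rewrite mxE.
Qed.

Lemma smooth_lorentz U Y Z : open U ->
  smooth U Y -> smooth U Z -> smooth U (fun p => lorentz (Y p) (Z p)).
Proof.
move=> oU YU ZU; rewrite (_ : (fun p => _) =
    fun p => \sum_i lorentz_sign i * (Y p 0 i * Z p 0 i)); last first.
  by apply/funext => p; rewrite lorentzE.
apply: smooth_sum => // i; apply: smoothM => //; first exact: smooth_cst.
by apply: smoothM => //; exact: smooth_coord.
Qed.

Lemma smooth_differential U psi (X : field M) : open U ->
  smooth U psi -> smooth_field U X ->
  smooth U (fun p => differential psi (X p)).
Proof.
move=> oU psiU XU; apply: smooth_row => // i; rewrite (_ : (fun p => _) =
    fun p => X p (fun p' => psi p' 0 i)); last first.
  by apply/funext => p; rewrite mxE.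
by apply: XU => //; exact: smooth_coord.
Qed.

Lemma smooth_coords q Z : smooth_near q Z -> coords_smooth_near q Z.
Proof.
by move=> [U [oU Uq ZU]] i; exists U; split=> //; exact: smooth_coord.
Qed.

Lemma differential_smooth_near q psi (X : field M) :
  smooth [set: M] psi -> smooth_field_near q X ->
  smooth_near q (fun p => differential psi (X p)).
Proof.
move=> psiT [U [oU Uq XU]]; exists U; split=> //.
by apply: smooth_differential => //; exact: sub_smooth psiT.
Qed.

End SmoothRows.

(** * The Gauss formula *)

Section Gauss.
Context {R : realType} {M : surface R} (psi : M -> 'rV[R]_4).
Context (nabla : forall q : M, tangent q -> field M -> tangent q).
Hypothesis psi_smooth : smooth [set: M] psi.
Hypothesis nablaP : levi_civita (induced_metric psi) nabla.

(** This is the second fundamental form, although its normality is known only after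
    [gauss_formula]. *)
Let second_form (q : M) (X Y : field M) : 'rV[R]_4 :=
  flat_connection (X q) (fun p => differential psi (Y p)) -
  differential psi (nabla (X q) Y).

(** Torsion-freeness, tested on each coordinate function of [psi], equates the antisymmetric parts
    of the two terms. *)
Lemma second_form_sym (q : M) (X Y : field M) :
  smooth_field_near q X -> smooth_field_near q Y ->
  second_form q X Y = second_form q Y X.
Proof.
move=> Xq Yq; apply/rowP => i.
have psiq : smooth_near q (fun p => psi p 0 i).
  exact/smooth_coords/smooth_nearT.
have := levi_civita_torsion_free nablaP Xq Yq psiq.
rewrite tangent_addE tangent_oppE !mxE => /eqP.
rewrite subr_eq addrAC eq_sym subr_eq => /eqP tor.
have dE (Z : field M) : (fun p => differential psi (Z p) 0 i) =
    (fun p => Z p (fun p' => psi p' 0 i)).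
  by apply/funext => p; rewrite mxE.
rewrite !dE; lra.
Qed.

(** The derivative of <psi_* Y, psi_* Z> is computed twice, by the flat connection and by [nabla];
    the difference of the two results is the claim. *)
Lemma second_form_skew (q : M) (X Y Z : field M) :
  smooth_field_near q Y -> smooth_field_near q Z ->
  lorentz (second_form q X Y) (differential psi (Z q)) =
  - lorentz (second_form q X Z) (differential psi (Y q)).
Proof.
move=> Yq Zq; have := levi_civita_metric nablaP Yq Zq (X q).
rewrite /induced_metric tangent_lorentz;
  try exact/smooth_coords/differential_smooth_near.
rewrite /second_form !lorentz_bilinear.
rewrite (lorentzC (differential psi (Y q)) (differential psi _)).
rewrite (lorentzC (differential psi (Y q)) (flat_connection _ _)).
lra.
Qed.

Lemma gauss_formula (q : M) (v w : tangent q) (Y : field M) :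
  smooth_field_near q Y ->
  lorentz (flat_connection v (fun p => differential psi (Y p)))
    (differential psi w) =
  lorentz (differential psi (nabla v Y)) (differential psi w).
Proof.
move=> Yq.
have [X Xq <-] := tangent_extension v; have [Z Zq <-] := tangent_extension w.
suff : lorentz (second_form q X Y) (differential psi (Z q)) = 0.
  by rewrite /second_form !lorentz_bilinear => /subr0_eq.
(* Alternating three symmetric swaps with three skew ones permutes X, Y, Z back to the initial order
   and changes the sign three times. *)
have E : lorentz (second_form q X Y) (differential psi (Z q)) =
  - lorentz (second_form q X Y) (differential psi (Z q)).
  rewrite {1}second_form_sym// second_form_skew// (second_form_sym Yq Zq).
  rewrite second_form_skew// opprK (second_form_sym Zq Xq).
  by rewrite second_form_skew.
lra.
Qed.

End Gauss.

(** Two candidates differ by a vector whose image under [differential psi] is normal as well as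
    tangent. Its induced square norm is then 0, so it vanishes by positive definiteness. Computing a
    shape operator thus reduces to checking normality. *)
Lemma shape_operator_eq (R : realType) (M : surface R) (psi : M -> 'rV[R]_4)
    (Z : M -> 'rV[R]_4) (q : M) (v w : tangent q) : spacelike psi ->
  normal_at psi q (flat_connection v Z + differential psi w) ->
  shape_operator psi Z v = w.
Proof.
move=> psiS nw; apply: xget_unique => /=.
  exists (flat_connection v Z + differential psi w) => //.
  by rewrite addrCA addNr addr0.
move=> w' [n nn nE]; apply/eqP; rewrite -subr_eq0; apply/negPn/negP => ww'.
have := spacelike_riemannian psiS ww'.
have -> : induced_metric psi (w' - w) (w' - w) =
    lorentz (n - (flat_connection v Z + differential psi w))
      (differential psi (w' - w)).
  rewrite /induced_metric nE; congr lorentz.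
  by rewrite differentialD differentialN opprD opprD opprK addrA addrA
    (addrC n) addrK.
by rewrite lorentzDl lorentzNl nn nw subr0 ltxx.
Qed.

Theorem proposition3p4 (R : realType) (M : surface R) (psi : M -> 'rV[R]_4)
    (psi_spacelike : spacelike psi)
    (psi_lightcone : range psi `<=` future_lightcone)
    (nabla : forall q : M, tangent q -> field M -> tangent q)
    (nabla_levi_civita : levi_civita (induced_metric psi) nabla)
    (grad_psi0 : field M)
    (grad_psi0P :
      is_gradient (induced_metric psi) (fun q => psi q 0 0) grad_psi0) :
  let xi : M -> 'rV[R]_4 := psi in
  let eta : M -> 'rV[R]_4 := fun q =>
    ((1 + induced_metric psi (grad_psi0 q) (grad_psi0 q))
       / (2 * psi q 0 0 ^+ 2)) *: xi q
    - (psi q 0 0)^-1 *: (partial0 + differential psi (grad_psi0 q)) in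
  [/\ normal_field psi xi /\ lightlike_field xi,
      normal_field psi eta /\ lightlike_field eta,
      forall (q : M) (v : tangent q), shape_operator psi xi v = - v
    & forall (q : M) (v : tangent q),
        shape_operator psi eta v =
          - ((1 + induced_metric psi (grad_psi0 q) (grad_psi0 q))
               / (2 * psi q 0 0 ^+ 2)) *: v
          + (psi q 0 0)^-1 *: second_derivative nabla grad_psi0 v].
Proof.
pose h q := psi q 0 0; pose dG q := differential psi (grad_psi0 q).
pose f q := (1 + lorentz (dG q) (dG q)) / (2 * h q ^+ 2).
move=> xi eta.
have [psiT _ _] := psi_spacelike; have [GT GP] := grad_psi0P.
have oT : open [set: M] by exact: openT.
have psi0 q : lorentz (psi q) (psi q) = 0.
  by apply: (psi_lightcone _ _).1; exists q.
have h_gt0 q : 0 < h q by apply: (psi_lightcone _ _).2; exists q.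
have h0 q : h q != 0 by rewrite gt_eqF.
have hT : smooth [set: M] h by exact: smooth_coord.
have hVT : smooth [set: M] (fun q => - (h q)^-1).
  rewrite (_ : (fun q => _) = fun q => -1 * (h q)^-1).
    by apply: smoothM => //; [exact: smooth_cst|exact: smoothV].
  by apply/funext => q; rewrite mulN1r.
have dGT : smooth [set: M] dG by exact: smooth_differential.
have fT : smooth [set: M] f.
  apply: smoothM => //.
    by apply: smoothD => //; [exact: smooth_cst|exact: smooth_lorentz].
  apply: smoothV => // [q _|].
    by rewrite mulf_neq0 ?pnatr_eq0// expf_neq0.
  by apply: smoothM; [|exact: smooth_cst|exact: smoothM].
pose nu q := partial0 + dG q.
have nuT : smooth [set: M] nu by apply: smoothD => //; exact: smooth_cst.
(* With the minus sign inside the coefficient, [eta] is a sum of scaled fields, as the rules for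
   [flat_connection] expect. *)
have etaE : eta = fun q => f q *: psi q + (- (h q)^-1) *: nu q.
  by apply/funext => q; rewrite scaleNr.
have Gq q : smooth_field_near q grad_psi0 by exists [set: M].
have normal_psi q (w : tangent q) : lorentz (psi q) (differential psi w) = 0.
  have psiq : coords_smooth_near q psi by exact/smooth_coords/smooth_nearT.
  have := tangent_lorentz w psiq psiq.
  rewrite (_ : (fun p => _) = fun=> 0) ?tangent_cst; last exact/funext.
  (* The flat derivative of the position vector [psi] along [w] is psi_* w itself, by definition. *)
  rewrite (lorentzC (flat_connection _ _)) -/(differential psi w) => /esym/eqP.
  by rewrite -mulr2n mulrn_eq0 => /eqP.
have normal_nu q (w : tangent q) : lorentz (nu q) (differential psi w) = 0.
  by rewrite lorentzDl lorentz_partial0 [lorentz (dG q) _]GP !mxE addNr.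
have nu_psi q : lorentz (nu q) (psi q) = - h q.
  by rewrite lorentzDl lorentz_partial0 lorentzC normal_psi addr0.
(* As [nu] is normal, its square is <nu, partial_0> = - nu_0, and the 0-component of psi_* grad
   psi_0 is the derivative of psi_0 along its gradient, that is, |grad psi_0|^2. *)
have nu_nu q : lorentz (nu q) (nu q) = - (1 + lorentz (dG q) (dG q)).
  rewrite {2}/nu lorentzDr normal_nu addr0 lorentzC lorentz_partial0.
  rewrite /nu !mxE [lorentz _ _]GP.
  by rewrite !eqxx.
have flat_nu q v (w : tangent q) :
    lorentz (flat_connection v nu) (differential psi w) =
    lorentz (differential psi (nabla q v grad_psi0)) (differential psi w).
  rewrite flat_connectionD; first last.
  - exact/smooth_coords/smooth_nearT.
  - exact: coords_smooth_near_cst.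
  by rewrite flat_connection_cst add0r (gauss_formula psiT nabla_levi_civita).
(* From here on [nu] enters only through the facts just recorded. *)
clearbody nu; split.
- split; first by split.
  move=> q; split; last exact: psi0.
  by apply/eqP => /rowP/(_ 0); rewrite mxE; exact/eqP/h0.
- rewrite etaE; split.
    split=> [|q w].
      by apply: smoothD => //; exact: smooth_rowZ.
    by rewrite lorentzDl !lorentzZl normal_psi normal_nu !mulr0 addr0.
  (* The normalization <eta, xi> = 1 shows that [eta] does not vanish and also shortens the
     computation of <eta, eta>. *)
  move=> q; have eta_psi :
      lorentz (f q *: psi q + (- (h q)^-1) *: nu q) (psi q) = 1.
    by rewrite lorentzDl !lorentzZl psi0 nu_psi mulr0 add0r mulrNN mulVf.
  split.
    apply/eqP => eta0; move: eta_psi; rewrite eta0 -(scale0r 0) lorentzZl mul0r.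
    by move/eqP; rewrite eq_sym oner_eq0.
  (* The square of [eta] is 2 f - (1 + |grad psi_0|^2) / h^2, which the choice of [f] makes 0. *)
  rewrite {1}lorentzDr !lorentzZr eta_psi lorentzDl.
  rewrite !lorentzZl (lorentzC (psi q)) nu_psi nu_nu /f; field.
  by rewrite h0.
(* Since D_v psi = psi_* v, the tangent vector [- v] leaves the normal component 0. *)
- move=> q v; apply: shape_operator_eq => // w.
  by rewrite differentialN subrr -(scale0r 0) lorentzZl mul0r.
- move=> q v; apply: shape_operator_eq => // w.
  rewrite -[(1 + _) / _]/(f q) -/(h q) etaE.
  have fq := smooth_nearT q fT; have hVq := smooth_nearT q hVT.
  have psiq : coords_smooth_near q psi by exact/smooth_coords/smooth_nearT.
  have nuq : coords_smooth_near q nu by exact/smooth_coords/smooth_nearT.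
  rewrite flat_connectionD; try exact: coords_smooth_nearZ.
  rewrite !flat_connectionZ// differentialD !differentialZ.
  (* The derivatives of the coefficients multiply [psi] and [nu], whose products with psi_* w
     vanish. The remaining terms cancel against the claimed value of the shape operator. *)
  rewrite !lorentz_bilinear normal_psi normal_nu flat_nu.
  rewrite /second_derivative -/(differential psi v); ring.
Qed.
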